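(* Fix $n\in\mathbb N$. The homomorphism of $\mathsf{FI}^{\mathrm{op}}$-modules \[ \chi\colon\mathbb Z\mathsf{FI}(-,n)\longrightarrow\mathbb Z\mathsf{CB}(-,n),\qquad f\longmapsto\sum_{\pi\in\mathsf{CB}(k,n)}\langle f,\pi\rangle\cdot\pi\quad(f\in\mathsf{FI}(k,n)) \] induces an isomorphism $\mathbb Z\mathsf{FI}(k,n)\xrightarrow{\cong}\mathbb Z\mathsf{CB}(k,n)$ if $n\ge 2k-1$. Moreover, when $n\ge 2k-1$, for every $f\in\mathsf{FI}(\ell,k)$ we have $f\cdot\chi^{-1}(x)=\chi^{-1}(f\cdot x)$ in $\mathbb Z\mathsf{FI}(\ell,n)$ for all $x\in\mathbb Z\mathsf{CB}(k,n)$.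
   Context: $\mathsf{FI}(k,n)$ is the set of injections $[k]\to[n]$, where $[n]=\{1,\dots,n\}$; $\mathbb ZX$ is the free abelian group on $X$. $\mathrm{Catalan}(\ell,n)=\{c\colon[\ell]\to[n]\text{ strictly increasing}\mid c(i)\ge 2i\text{ for all }i\in[\ell]\}$. For $c\in\mathrm{Catalan}(\ell,n)$, let $\mathsf{CB}^c_\ell(k,n)=\pi_0(\{\phi\in\mathrm{Emb}([k],\operatorname{im}c\sqcup\mathbb R)\mid\operatorname{im}c\subseteq\operatorname{im}\phi\})$, where $\mathrm{Emb}$ is the space of injective maps ($\operatorname{im} c$ discrete). Let $\mathsf{CB}_\ell(k,n)=\bigsqcup_{c\in\mathrm{Catalan}(\ell,n)}\mathsf{CB}^c_\ell(k,n)$ and $\mathsf{CB}(k,n)=\bigsqcup_{\ell\in\mathbb N}\mathsf{CB}_\ell(k,n)$. $\mathbb Z\mathsf{FI}(-,n)$ and $\mathbb Z\mathsf{CB}(-,n)$ are $\mathsf{FI}^{\mathrm{op}}$-modules by precomposition, written as a left action: $g\in\mathsf{FI}(k',k)$ sends $f\in\mathsf{FI}(k,n)$ to $g\cdot f=f\circ g$, and sends the class of $\phi$ in $\mathsf{CB}^c_\ell(k,n)$ to the class of $\phi\circ g$ in $\mathsf{CB}^c_\ell(k',n)$ if $\operatorname{im}c\subseteq\operatorname{im}(\phi\circ g)$, and to $0$ otherwise. An injection $f\in\mathsf{FI}(k,n)$ matches $\pi\in\mathsf{CB}^c_\ell(k,n)$ with representative $\phi$ if $f(i)=\phi(i)$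 whenever $\phi(i)\in\operatorname{im}c$, and $f(i)<f(j)\iff\phi(i)<\phi(j)$ whenever $\phi(i),\phi(j)\in\mathbb R$. Set $\langle f,\pi\rangle=1$ if $f$ matches $\pi$ and $0$ otherwise. *)

(* Defs.v *)
From HB Require Import structures.
From mathcomp Require Import all_boot all_order all_algebra.
From mathcomp Require Import all_classical all_reals topology normedtype.
From mathcomp Require Import unstable homotopy freeg ring lra.

Set Implicit Arguments.
Unset Strict Implicit.
Unset Printing Implicit Defensive.

Import Order.TTheory GRing.Theory Num.Theory.
Import numFieldNormedType.Exports.

Local Open Scope classical_set_scope.
Local Open Scope ring_scope.
Local Open Scope quotient_scope.

Section UnitInterval.
Variable R : realType.

Definition unit_itv : Type := set_type (`[0, 1]%classic : set R).
HB.instance Definition _ := Topological.on unit_itv.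

Lemma unit_itvP (t : R) : (t \in (`[0, 1]%classic : set R)) = (0 <= t <= 1).
Proof. by rewrite mem_setE in_itv. Qed.

Lemma itv0_subproof : (0 : R) \in (`[0, 1]%classic : set R).
Proof. by rewrite unit_itvP lexx ler01. Qed.

Lemma itv1_subproof : (1 : R) \in (`[0, 1]%classic : set R).
Proof. by rewrite unit_itvP lexx ler01. Qed.

Definition itv0 : unit_itv := exist _ 0 itv0_subproof.
Definition itv1 : unit_itv := exist _ 1 itv1_subproof.

Lemma itv01_neq : itv0 != itv1.
Proof. by apply/eqP => /(congr1 val) /= /esym/eqP; rewrite oner_eq0. Qed.

HB.instance Definition _ := isBiPointed.Build unit_itv itv01_neq.

Definition clampR (t : R) : R := (`|t| - `|t - 1| + 1) / 2.

Lemma clampR_id t : 0 <= t <= 1 -> clampR t = t.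
Proof.
move=> /andP[t0 t1]; rewrite /clampR ger0_norm// ler0_norm ?subr_le0//.
by field.
Qed.

Lemma clampR_itv t : clampR t \in (`[0, 1]%classic : set R).
Proof.
rewrite unit_itvP /clampR; apply/andP; split; case: (ler0P t) => ?;
  case: (ler0P (t - 1)) => ?; lra.
Qed.

Definition clamp (t : R) : unit_itv := exist _ (clampR t) (clampR_itv t).

Lemma clampK (s : unit_itv) : clamp (val s) = s.
Proof.
by apply/val_inj => /=; apply: clampR_id; rewrite -unit_itvP (valP s).
Qed.

Lemma clamp_continuous : continuous clamp.
Proof.
apply: (@continuous_comp_initial _ _ _ (@set_val R `[0, 1]%classic)).
have -> : set_val \o clamp = clampR by [].
move=> t; apply: cvgM; last exact: cvg_cst.
apply: cvgD; last exact: cvg_cst.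
apply: cvgB; apply: cvg_norm; first exact: cvg_id.
by apply: cvgB; [exact: cvg_id|exact: cvg_cst].
Qed.

Lemma val_unit_itv_continuous : continuous (val : unit_itv -> R).
Proof. exact: (@initial_continuous _ _ (@set_val R `[0, 1]%classic)). Qed.

End UnitInterval.

Section Pi0.
Variables (R : realType) (X : topologicalType).

Definition joined (x y : X) : bool :=
  `[< inhabited {path (unit_itv R) from x to y} >].

(* A path can equally be parametrised by the whole real line. *)
Lemma joinedP x y :
  reflect (exists g : R -> X, [/\ continuous g, g 0 = x & g 1 = y])
          (joined x y).
Proof.
apply: (iffP (asboolP _)) => [[p]|[g [cg <- <-]]].
  have cp : continuous p := @cts_fun _ _ p.
  exists (p \o @clamp R); split.
  - by move=> t; apply: continuous_comp; [exact: clamp_continuous|exact: cp].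
  - by rewrite /= (_ : clamp 0 = zero) ?path_zero// -[zero](clampK).
  - by rewrite /= (_ : clamp 1 = one) ?path_one// -[one](clampK).
have cgv : continuous (g \o (val : unit_itv R -> R)).
  by move=> t; apply: continuous_comp; [exact: val_unit_itv_continuous|exact: cg].
by split; exact: (mk_path cgv erefl erefl).
Qed.

Lemma joined_refl : reflexive joined.
Proof. by move=> x; apply/joinedP; exists (cst x); split => // t; exact: cvg_cst. Qed.

Lemma joined_sym : symmetric joined.
Proof.
suff H x y : joined x y -> joined y x by move=> x y; apply/idP/idP; exact: H.
move=> /joinedP[g [cg g0 g1]]; apply/joinedP.
exists (g \o (fun t => 1 - t)); split; rewrite /= ?subr0 ?subrr//.
move=> t; apply: continuous_comp; last exact: cg.
by apply: cvgB; [exact: cvg_cst|exact: cvg_id].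
Qed.

Lemma joined_trans : transitive joined.
Proof.
move=> y x z /joinedP[p [cp p0 p1]] /joinedP[q [cq q0 q1]]; apply/joinedP.
pose g (t : R) := if t <= 1 then p t else q (t - 1).
have cg : continuous g.
  apply/continuous_subspace_setT.
  have -> : setT = [set t : R | t <= 1] `|` [set t : R | 1 <= t].
    by apply/seteqP; split => // t _ /=; case: (lerP t 1) => [|/ltW]; [left|right].
  apply: withinU_continuous; [exact: closed_le|exact: closed_ge| |].
    apply: (@subspace_eq_continuous _ _ _ p); last exact: continuous_subspaceT.
    by move=> t; rewrite inE /= => t1; rewrite /from_subspace /= /g t1.
  have cq' : {within [set t : R | 1 <= t], continuous (fun t : R => q (t - 1))}.
    apply: continuous_subspaceT => t.
    apply: (@continuous_comp _ _ _ (fun t : R => t - 1) q); last exact: cq.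
    by apply: cvgB; [exact: cvg_id|exact: cvg_cst].
  apply: subspace_eq_continuous cq' => t; rewrite inE /= => t1.
  rewrite /from_subspace /= /g; case: ifPn => // t1'.
  have -> : t = 1 by apply/eqP; rewrite eq_le t1 t1'.
  by rewrite subrr p1 q0.
exists (g \o (fun t => 2 * t)); split.
- move=> t; apply: continuous_comp; last exact: cg.
  by apply: cvgM; [exact: cvg_cst|exact: cvg_id].
- by rewrite /= mulr0 /g ler01.
- rewrite /= mulr1 /g ifF; last by apply/negbTE; rewrite -ltNge; lra.
  by rewrite (_ : 2 - 1 = 1)//; lra.
Qed.

Canonical joined_equiv := EquivRel joined joined_refl joined_sym joined_trans.

Definition pi0 : Type := {eq_quot joined}.
HB.instance Definition _ := Choice.on pi0.
HB.instance Definition _ := EqQuotient.on pi0.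

End Pi0.

Arguments joined R {X}.

(* coprod X Y is the disjoint union of X (tag true) and Y (tag false). *)
Section Coproduct.
Variables X Y : topologicalType.

Definition coprod_fam (b : bool) : topologicalType := if b then X else Y.
Definition coprod : Type := {b : bool & coprod_fam b}.
HB.instance Definition _ := Topological.on coprod.

Definition inX (x : X) : coprod := existT coprod_fam true x.
Definition inY (y : Y) : coprod := existT coprod_fam false y.

End Coproduct.
Arguments inX {X Y}.
Arguments inY {X Y}.

(* [n] is encoded as 'I_n, shifted by one: the ordinal i stands for i.+1. *)
Definition FI (k n : nat) := {f : {ffun 'I_k -> 'I_n} | injectiveb f}.

HB.instance Definition _ k n := Choice.on (FI k n).

Definition FI_fun k n (f : FI k n) : 'I_k -> 'I_n := val f.
Coercion FI_fun : FI >-> Funclass.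

Lemma FI_inj k n (f : FI k n) : injective f.
Proof. by apply/injectiveP; exact: valP f. Qed.

Lemma FI_comp_subproof k' k n (f : FI k n) (g : FI k' k) :
  injectiveb [ffun i => f (g i)].
Proof.
by apply/injectiveP => i j; rewrite !ffunE => /FI_inj/FI_inj.
Qed.

Definition FI_comp k' k n (f : FI k n) (g : FI k' k) : FI k' n :=
  Sub [ffun i => f (g i)] (FI_comp_subproof f g).

(* With the shift above, c(i) >= 2i for i in [l] reads 2 * i.+1 <= (c i).+1. *)
Definition Catalan (l n : nat) :=
  {c : {ffun 'I_l -> 'I_n} |
    [forall i : 'I_l, forall j : 'I_l, (i < j)%N ==> (c i < c j)%N]
    && [forall i : 'I_l, (2 * i.+1 <= (c i).+1)%N]}.

HB.instance Definition _ l n := Choice.on (Catalan l n).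

Definition im l n (c : Catalan l n) : Type :=
  discrete_topology {x : 'I_n | x \in codom (val c)}.
HB.instance Definition _ l n (c : Catalan l n) :=
  DiscreteTopology.on (im c).

Section CB.
Variable R : realType.

Definition target l n (c : Catalan l n) := coprod (im c) R.

Definition EmbC k l n (c : Catalan l n) : set {ptws 'I_k -> target c} :=
  [set phi : {ptws 'I_k -> target c} |
    injective (phi : 'I_k -> target c) /\ forall x : im c, exists i, phi i = inX x].

Arguments EmbC k {l n} c.

Definition CBc k l n (c : Catalan l n) := pi0 R (EmbC k c).
Definition CBl k l n := {c : Catalan l n & CBc k c}.
Definition CB k n := {l : nat & CBl k l n}.

HB.instance Definition _ k l n := Choice.on (CBl k l n).
HB.instance Definition _ k n := Choice.on (CB k n).

Definition CB_class k l n (c : Catalan l n) (phi : EmbC k c) : CB k n :=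
  existT _ l (existT _ c (\pi_(CBc k c) phi)).

Definition matches k l n (f : FI k n) (c : Catalan l n) (phi : EmbC k c) : Prop :=
  (forall i (x : im c), val phi i = inX x -> f i = val x) /\
  (forall i j (s t : R), val phi i = inY s -> val phi j = inY t ->
     (f i < f j)%N <-> s < t).

Definition pairing k n (f : FI k n) (p : CB k n) : int :=
  let: existT _ (existT _ q) := p in `[< matches f (repr q) >]%:R.

Definition ZFI k n := {freeg (FI k n) / int}.
Definition ZCB k n := {freeg (CB k n) / int}.

HB.instance Definition _ k n := GRing.Lmodule.on (ZFI k n).
HB.instance Definition _ k n := GRing.Lmodule.on (ZCB k n).

Definition actFI k' k n (g : FI k' k) : ZFI k n -> ZFI k' n :=
  fglift (fun f => << FI_comp f g >>).

(* phi \o g is always injective, so [insub] fails only when im c is not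
   contained in im (phi \o g), see [isSome_restr]. *)
Definition restr k' k l n (c : Catalan l n) (phi : EmbC k c) (g : FI k' k)
  : option (EmbC k' c) :=
  insub ((val phi \o g) : {ptws 'I_k' -> target c}).

Definition actCB k' k n (g : FI k' k) : ZCB k n -> ZCB k' n :=
  fglift (fun p : CB k n =>
    let: existT l (existT c q) := p in
    if restr (repr q) g is Some psi then << CB_class psi >> else 0 : ZCB k' n).

(* [\sum_(p \in A) _] is the finitely supported sum of fsbigop: a given f matches
   at most one class for each of the finitely many c. *)
Definition chi k n : ZFI k n -> ZCB k n :=
  fglift (fun f => \sum_(p \in [set: CB k n]) (pairing f p *: << p >> : ZCB k n)).

End CB.

Arguments EmbC R k {l n} c.
Arguments CBc R k {l n} c.
Arguments actCB R {k' k n} g.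
Arguments chi R {k n}.

(* The pairing and the action are defined through the representative chosen by
   [repr]; [pairing_class] and [actCB_class] below show that any representative
   gives the same result, and [isSome_restr] that the zero case of the action
   is exactly the failure of im c to be contained in im (phi \o g). *)

Lemma ptws_continuous (T : topologicalType) I (Y : topologicalType)
    (f : T -> {ptws I -> Y}) :
  (forall i, continuous (f ^~ i)) -> continuous f.
Proof.
move=> cf x; apply/cvg_sup => i; move: x.
by apply/(@continuous_comp_initial _ _ _ (fun phi : I -> Y => phi i))/cf.
Qed.

Section Invariance.
Variables (R : realType).

Lemma IVT_line (h : R -> R) s t v :
  continuous h -> h s <= v <= h t -> exists u, h u = v.
Proof.
move=> ch /andP[sv vt].
have ch' a b : {within `[a, b], continuous h} by exact: continuous_subspaceT.
case: (lerP s t) => st.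
  have [|u _ <-] := IVT st (ch' _ _) (v := v); last by exists u.
  by rewrite ge_min sv le_max vt orbT.
have [|u _ <-] := IVT (ltW st) (ch' _ _) (v := v); last by exists u.
by rewrite ge_min sv orbT le_max vt.
Qed.

Variables (k l n : nat) (c : Catalan l n).

Definition labelX (x : im c) : target R c -> R :=
  sigT_fun (fun b : bool => if b return coprod_fam (im c) R b -> R
                            then fun y => (y == x)%:R else fun=> 0).

Definition coordY : target R c -> R :=
  sigT_fun (fun b : bool => if b return coprod_fam (im c) R b -> R
                            then fun=> 0 else id).

Lemma labelX_continuous x : continuous (labelX x).
Proof.
apply: sigT_continuous => -[] /=; last by move=> t; exact: cvg_cst.
by apply/continuousP => A _; exact: (@discrete_open (im c)).
Qed.

Lemma coordY_continuous : continuous coordY.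
Proof.
by apply: sigT_continuous => -[] /= t; [exact: cvg_cst|exact: cvg_id].
Qed.

Lemma inX_inj (x y : im c) : inX x = inX y :> target R c -> x = y.
Proof.
move=> h; have := congr1 (labelX x) h.
rewrite /labelX /sigT_fun /= eqxx; case: eqP => // _ /eqP; by rewrite oner_eq0.
Qed.

Lemma labelXE x z : labelX x z = `[< z = inX x >]%:R.
Proof.
case: z => -[] z; rewrite /labelX /sigT_fun /=.
  by congr ((nat_of_bool _)%:R); apply/eqP/asboolP => [->//|/inX_inj].
by case: asboolP => // h; have := congr1 tag h.
Qed.

Lemma EmbC_coord_continuous (g : R -> EmbC R k c) (i : 'I_k) :
  continuous g -> continuous (fun t => val (g t) i : target R c).
Proof.
move=> cg t.
apply: (@continuous_comp _ _ _ (fun t => val (g t) : {ptws 'I_k -> target R c})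
  (fun phi => phi i)); last exact: (@proj_continuous _ (fun=> target R c)).
apply: (@continuous_comp _ _ _ g); first exact: cg.
exact: (@initial_continuous _ _ (@set_val _ (EmbC R k c))).
Qed.

Lemma path_inX (g : R -> EmbC R k c) (i : 'I_k) (x : im c) s t :
  continuous g -> val (g s) i = inX x -> val (g t) i = inX x.
Proof.
move=> cg gs; apply: contrapT => gt.
pose h u := labelX x (val (g u) i).
have ch : continuous h.
  move=> u; apply: (@continuous_comp _ _ _ (fun u => val (g u) i : target R c)).
    exact: EmbC_coord_continuous.
  exact: labelX_continuous.
have [|u] := @IVT_line h t s 2^-1 ch.
  by rewrite /h !labelXE gs (asboolT erefl) (asboolF gt) /=; lra.
by rewrite /h labelXE; case: asboolP => _ /=; lra.
Qed.

Lemma path_inY (g : R -> EmbC R k c) (i : 'I_k) (r : R) s t :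
  continuous g -> val (g s) i = inY r -> exists r', val (g t) i = inY r'.
Proof.
move=> cg gs; case gt : (val (g t) i) => [[] r']; last by exists r'.
by have := path_inX s cg gt; rewrite gs => h; have := congr1 tag h.
Qed.

Lemma path_ltY (g : R -> EmbC R k c) (i j : 'I_k) (r r' q q' : R) s t :
  continuous g ->
  val (g s) i = inY r -> val (g s) j = inY r' ->
  val (g t) i = inY q -> val (g t) j = inY q' -> r < r' -> q < q'.
Proof.
move=> cg gsi gsj gti gtj rr'; rewrite ltNge; apply/negP => qq'.
pose h u := coordY (val (g u) j) - coordY (val (g u) i).
have ch : continuous h.
  have ch1 a : continuous (fun u => coordY (val (g u) a)).
    move=> u; apply: (@continuous_comp _ _ _ (fun u => val (g u) a : target R c)).
      exact: EmbC_coord_continuous.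
    exact: coordY_continuous.
  by move=> u; apply: cvgB; exact: ch1.
have [|u] := @IVT_line h t s 0 ch.
  by rewrite /h gsi gsj gti gtj /coordY /sigT_fun /=; lra.
have [a ga] := path_inY u cg gsi; have [b gb] := path_inY u cg gsj.
rewrite /h ga gb /coordY /sigT_fun /= => /eqP; rewrite subr_eq0 => /eqP ab.
have [inj _] := set_mem (valP (g u)).
have ij : i = j by apply: inj; rewrite /= ga gb ab.
move: gsj rr'; rewrite -ij gsi => /(congr1 coordY); rewrite /coordY /sigT_fun /= => ->.
by rewrite ltxx.
Qed.

Lemma matches_joined (f : FI k n) (phi psi : EmbC R k c) :
  joined R phi psi -> matches f phi -> matches f psi.
Proof.
move=> /joinedP[g [cg <- <-]] [m1 m2]; split => [i x /path_inX|i j s t gi gj].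
  by move=> /(_ 0 cg) /m1.
have [s' gi'] := path_inY 0 cg gi; have [t' gj'] := path_inY 0 cg gj.
apply: (iff_trans (m2 _ _ _ _ gi' gj')); split.
- exact: path_ltY cg gi' gj' gi gj.
- exact: path_ltY cg gi gj gi' gj'.
Qed.

Lemma pairing_class (f : FI k n) (phi : EmbC R k c) :
  pairing f (CB_class phi) = `[< matches f phi >]%:R.
Proof.
rewrite /pairing /CB_class; congr ((nat_of_bool _)%:R); apply/asbool_equiv_eq.
have j : joined R phi (repr (\pi_(CBc R k c) phi)).
  by apply/eqmodP; rewrite reprK.
by split; apply: matches_joined => //; rewrite joined_sym.
Qed.

Variable k' : nat.

Lemma isSome_restr (phi : EmbC R k c) (g : FI k' k) :
  restr phi g <-> forall x : im c, exists i, val phi (g i) = inX x.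
Proof.
rewrite /restr; case: insubP => [psi /set_mem[_ +] _|/negP nE]; split => //.
move=> cov; exfalso; apply: nE; apply/mem_set; split => //.
have [inj _] := set_mem (valP phi).
by move=> i j /inj /FI_inj.
Qed.

Lemma val_restr (phi : EmbC R k c) (g : FI k' k) psi :
  restr phi g = Some psi -> val psi = val phi \o g.
Proof. by rewrite /restr; case: insubP => // u _ <- [<-]. Qed.

Lemma restr_joined (phi psi : EmbC R k c) (g : FI k' k) phi' :
  joined R phi psi -> restr phi g = Some phi' ->
  exists2 psi', restr psi g = Some psi' & joined R phi' psi'.
Proof.
move=> /joinedP[h [ch h0 h1]] hphi.
have hs t : restr (h t) g.
  apply/isSome_restr => x.
  have /isSome_restr/(_ x)[i gi] : restr phi g by rewrite hphi.
  by exists i; apply: (path_inX (s := 0)) => //; rewrite h0.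
pose h' t := odflt phi' (restr (h t) g).
have hE t : restr (h t) g = Some (h' t).
  by rewrite /h'; case: (restr (h t) g) (hs t).
exists (h' 1); first by rewrite -h1.
apply/joinedP; exists h'; split => //; last by rewrite /h' h0 hphi.
apply: (@continuous_comp_initial _ _ _ (@set_val _ (EmbC R k' c))).
apply: ptws_continuous => i.
have -> : (fun t => (set_val \o h') t i) = (fun t => val (h t) (g i)).
  by apply/funext => t; rewrite /= [set_val _](val_restr (hE t)).
exact: EmbC_coord_continuous.
Qed.

Lemma actCB_class (g : FI k' k) (phi : EmbC R k c) :
  actCB R g << CB_class phi >> =
  if restr phi g is Some psi then << CB_class psi >> else 0.
Proof.
rewrite /actCB liftU scale1r /CB_class.
set rho := repr _.
have j : joined R phi rho by apply/eqmodP; rewrite reprK.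
case E : (restr phi g) => [phi'|].
  have [rho' -> j'] := restr_joined j E; rewrite /CB_class.
  by have -> : \pi_(CBc R k' c) rho' = \pi_(CBc R k' c) phi' by apply/esym/eqmodP.
case E' : (restr rho g) => [rho'|//].
have j' : joined R rho phi by rewrite joined_sym.
by have [? +] := restr_joined j' E'; rewrite E.
Qed.
End Invariance.

(* Main.v *)
(* Read [f : [k] -> [n]] as a word of length n over [k] plus a blank, letter j
   being the i with f(i) = j.  A class in CB(k,n) becomes a pair (v, u): v is the
   partial word recording the i sent to im c, and u lists the remaining labels by
   decreasing real coordinate.  Then chi pairs w with (v, u) exactly when w is
   obtained from v by inserting u, in order, into blanks of v.

   On coefficients chi therefore sends x to (v, u) |-> the sum of x over these w.
   We show, for all k and n, that it is a bijection onto the functions of the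
   ballot codes with fewer than min(k + 1, n + 1 - k) letters in v, by induction
   on n, splitting off the last letter.  The truncation is what makes the
   induction work below n = 2k; for n >= 2k - 1 it discards nothing. *)
Require Import Defs.
From HB Require Import structures.
From mathcomp Require Import all_boot all_order all_algebra.
From mathcomp Require Import all_classical all_reals topology normedtype.
From mathcomp Require Import freeg zify ring.

Set Implicit Arguments.
Unset Strict Implicit.
Unset Printing Implicit Defensive.

Import Order.TTheory GRing.Theory Num.Theory.
Import numFieldNormedType.Exports.
Local Open Scope classical_set_scope.
Local Open Scope ring_scope.
Local Open Scope quotient_scope.

(** * Words and codes *)

Section Words.
Variable T : choiceType.
Implicit Types (v w : seq (option T)) (u : seq T) (k n : nat).

Definition wt v := count isSome v.

Fixpoint fill v u : seq (seq (option T)) :=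
  match v, u with
  | [::], [::] => [:: [::]]
  | [::], _ => [::]
  | Some a :: v', _ => [seq Some a :: w | w <- fill v' u]
  | None :: v', [::] => [seq None :: w | w <- fill v' u]
  | None :: v', a :: u' =>
      [seq None :: w | w <- fill v' u] ++ [seq Some a :: w | w <- fill v' u']
  end.

(** Counting positions from the right end, starting at 1, the suffix headed by the i-th letter has
    length c(i), so the test is the Catalan inequality c(i) >= 2i. *)
Fixpoint ballot v : bool :=
  if v is b :: v' then ballot v' && (b ==> (2 * (wt v').+1 <= (size v').+1)%N)
  else true.

Definition in_range k n v u :=
  [&& size v == n, wt v + size u == k, ballot v
    & (wt v < minn k.+1 (n.+1 - k))%N]%N.

Lemma ballot_wt v : ballot v -> (2 * wt v <= size v)%N.
Proof.
by elim: v => //= -[a|] v IH /andP[/IH]; rewrite /wt /=; lia.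
Qed.

Lemma fill_size_wt v u w :
  w \in fill v u -> size w = size v /\ wt w = (wt v + size u)%N.
Proof.
elim: v u w => [[|a u] w|[a|] v IH u w] /=; rewrite ?inE //.
- by move/eqP->.
- by case/mapP => w' /IH[s t] ->; rewrite /wt /= in t *; rewrite s t addnA.
have N w' : w' \in fill v u -> w = None :: w' ->
    size w = (size v).+1 /\ wt w = (wt v + size u)%N.
  by move=> /IH[s t] ->; rewrite /= s /wt /= add0n.
case: u N => [|a u] N.
  by case/mapP => w' /N.
rewrite mem_cat => /orP[] /mapP[w']; first by move/N.
by move=> /IH[s t] ->; rewrite /wt /= in t *; rewrite s t; split=> //; lia.
Qed.

Lemma fill_uniq v u : uniq (fill v u).
Proof.
have ci (b : option T) : injective (cons b) by move=> x y [].
elim: v u => [|[a|] v IH] [|a' u] //=; rewrite ?(map_inj_uniq (ci _)) //.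
rewrite cat_uniq !(map_inj_uniq (ci _)) !IH andbT /=.
by apply/hasPn => w /mapP[w' _ ->]; apply/mapP => -[].
Qed.

Lemma fill_neq0 v u :
  (wt v + size u <= size v)%N -> exists w, w \in fill v u.
Proof.
elim: v u => [|[a|] v IH] u; rewrite /wt /= => h.
- by case: u h => // _; exists [::].
- by have [|w wf] := IH u; [rewrite /wt; lia|exists (Some a :: w); apply: map_f].
case: u h => [|a u] h.
  have [|w wf] := IH [::]; last by exists (None :: w); apply: map_f.
  by rewrite /= addn0; exact: count_size.
have [|w wf] := IH u; first by move: h; rewrite /wt /=; lia.
by exists (Some a :: w); rewrite mem_cat (map_f _ wf) orbT.
Qed.

(** * Sums over fillings as a linear system *)

Variable V : zmodType.
Implicit Types x y : seq (option T) -> V.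

Definition fill_sum x v u : V := \sum_(w <- fill v u) x w.

Lemma fill_sum_Some x a v u :
  fill_sum x (Some a :: v) u = fill_sum (x \o cons (Some a)) v u.
Proof. by rewrite /fill_sum /= big_map. Qed.

Lemma fill_sum_None0 x v :
  fill_sum x (None :: v) [::] = fill_sum (x \o cons None) v [::].
Proof. by rewrite /fill_sum /= big_map. Qed.

Lemma fill_sum_None x a v u :
  fill_sum x (None :: v) (a :: u) =
  fill_sum (x \o cons None) v (a :: u) + fill_sum (x \o cons (Some a)) v u.
Proof. by rewrite /fill_sum /= big_cat /= !big_map. Qed.

Lemma fill_sum_eq0 x v u :
  (forall w, size w = size v -> wt w = (wt v + size u)%N -> x w = 0) ->
  fill_sum x v u = 0.
Proof.
by move=> x0; rewrite /fill_sum big_seq big1 // => w /fill_size_wt[]; apply: x0.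
Qed.

(** A code headed by a letter only sees words with that head; one headed by a blank also sees words
    in which the first label of [u] fills this blank. Once [x] vanishes on one kind of word, the
    mixed equations lose that contribution, and the other kind reduces to tails of length [n]. *)
Lemma fill_sum_inj n k x :
  (forall v u, in_range k n v u -> fill_sum x v u = 0) ->
  forall w, size w = n -> wt w = k -> x w = 0.
Proof.
elim: n k x => [|n IH] k x x0 w sw kw.
  move/size0nil: sw kw x0 => -> /= <- /(_ [::] [::]).
  by rewrite /fill_sum /= big_seq1; apply.
have IHS a k' : (forall v u, in_range k' n v u ->
    fill_sum (x \o cons (Some a)) v u = 0) ->
    forall w', size w' = n -> wt w' = k' -> x (Some a :: w') = 0.
  exact: (IH k' (x \o cons (Some a))).
have IHN : (forall v u, in_range k n v u ->
    fill_sum (x \o cons None) v u = 0) ->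
    forall w', size w' = n -> wt w' = k -> x (None :: w') = 0.
  exact: (IH k (x \o cons None)).
have xS a v u : in_range k n.+1 (Some a :: v) u ->
    fill_sum (x \o cons (Some a)) v u = 0.
  by move=> /x0; rewrite fill_sum_Some.
have xN a v u : in_range k n.+1 (None :: v) (a :: u) ->
    fill_sum (x \o cons None) v (a :: u) + fill_sum (x \o cons (Some a)) v u = 0.
  by move=> /x0; rewrite fill_sum_None.
have xN0 v : in_range k n.+1 (None :: v) [::] ->
    fill_sum (x \o cons None) v [::] = 0.
  by move=> /x0; rewrite fill_sum_None0.
(* For 2k <= n + 1 the words starting with a letter are treated first.  Otherwise
   the words starting with a blank are: when v has maximal weight the code
   (Some a :: v, u) is out of range, and the letter part has to be read off
   (None :: v, a :: u). *)
case: (leqP (2 * k) n.+1) => hk.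
  (* Here [wt v <= k - 1], so [2 * k <= n.+1] gives both the ballot inequality at the new head
     letter and the weight bound. *)
  have S0 a k' : k = k'.+1 ->
      forall w', size w' = n -> wt w' = k' -> x (Some a :: w') = 0.
    move=> kk'; apply: IHS => v u /and4P[sv wv bv lv]; apply: xS.
    by rewrite /in_range /= bv; move: wv lv; rewrite /wt /=; lia.
  case: w sw kw => [//|[a|] w] /= [sw] kw; first by apply: (S0 a (wt w)).
  apply: IHN => // v u /and4P[sv wv bv lv].
  have rN : in_range k n.+1 (None :: v) u.
    by rewrite /in_range /= bv; move: wv lv; rewrite /wt /=; lia.
  case: u wv rN => [|a u] wv rN; first exact: xN0.
  have := xN _ _ _ rN.
  rewrite (@fill_sum_eq0 (x \o cons (Some a))) ?addr0 // => w' sw' ww'.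
  by apply: (S0 a k.-1); move: wv sv ww' => /=; lia.
(* From [wt v <= n - k] and [n.+1 < 2 * k] follows [2 * (wt v).+1 <= n.+1], the ballot inequality at
   the new head. *)
have xS' a v u : in_range k.-1 n v u -> (wt v < n.+1 - k)%N ->
   fill_sum (x \o cons (Some a)) v u = 0.
  move=> /and4P[sv wv bv lv] lv'; apply: xS.
  by rewrite /in_range /= bv; move: wv lv lv'; rewrite /wt /=; lia.
have N0 : forall w', size w' = n -> wt w' = k -> x (None :: w') = 0.
  apply: IHN => // v u /and4P[sv wv bv lv].
  have rN : in_range k n.+1 (None :: v) u.
    by rewrite /in_range /= bv; move: wv lv; rewrite /wt /=; lia.
  case: u wv rN => [|a u] wv rN; first exact: xN0.
  have := xN _ _ _ rN; rewrite xS' ?addr0 //; last by lia.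
  by rewrite /in_range /= bv; move: wv lv; rewrite /wt /=; lia.
case: w sw kw => [//|[a|] w] /= [sw] kw; last exact: N0.
apply: (IHS a k.-1) => //; last by move: kw; rewrite /wt /=; lia.
move=> v u r; have /and4P[sv wv bv lv] := r.
case: (ltnP (wt v) (n.+1 - k)) => lv'; first exact: xS'.
have /xN : in_range k n.+1 (None :: v) (a :: u).
  by rewrite /in_range /= bv; move: wv lv; rewrite /wt /=; lia.
rewrite fill_sum_eq0 ?add0r // => w' sw' ww'.
by apply: N0; move: wv sv ww' => /=; lia.
Qed.

(** Back-substitution in the same order as for injectivity: [x] is chosen first on one kind of head,
    with the right-hand sides corrected by the known or prescribed contribution of the other
    kind. *)
Lemma fill_sum_surj n k (y : seq (option T) -> seq T -> V) :
  exists x, forall v u, in_range k n v u -> fill_sum x v u = y v u.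
Proof.
elim: n k y => [|n IH] k y.
  (* For [n = 0] the bound [wt v < 1 - k] leaves only the empty code. *)
  exists (fun=> y [::] [::]) => v u /and4P[/nilP-> /eqP<- _].
  by case: u => [|a u]; rewrite /fill_sum ?big_seq1 //= /wt /=; lia.
case: (leqP (2 * k) n.+1) => hk.
  have /choice[xS hS] : forall a, exists x, forall v u,
      in_range k.-1 n v u -> fill_sum x v u = y (Some a :: v) u.
    by move=> a; exact: IH.
  have [xN hN] := IH k (fun v u =>
    y (None :: v) u - (if u is a :: u' then fill_sum (xS a) v u' else 0)).
  exists (fun w =>
    if w is b :: w' then if b is Some a then xS a w' else xN w' else 0).
  move=> v u /and4P[sv wv bv lv].
  case: v sv wv bv lv => [//|[a|] v] sv wv bv lv.
    rewrite fill_sum_Some; apply: hS; rewrite /in_range.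
    by move: sv wv bv lv => /=; case: (ballot v) => //; rewrite /wt /=; lia.
  (* Dropping the head lowers the weight bound by one. The lost value [wt v = n.+1 - k] would, with
     [wt v <= k] and [2 * k <= n.+1], force [2 * wt v = n.+1], against the ballot bound
     [2 * wt v <= n]. *)
  have rN : in_range k n v u.
    have bv' : ballot v by case/andP: bv.
    have := ballot_wt bv'; rewrite /in_range bv'; move: sv wv lv.
    by rewrite /wt /=; lia.
  case: u {wv} rN => [|a u] rN; first by rewrite fill_sum_None0 hN // subr0.
  by rewrite fill_sum_None hN // subrK.
have [xN hN] := IH k (fun v u =>
    y (None :: v) u - (if u is a :: u' then y (Some a :: v) u' else 0)).
(* At maximal weight the code headed by [a] is out of range; the letter part then takes what the
   blank-headed equation leaves after [xN]. *)
pose yS a v u := if (wt v < n.+1 - k)%N then y (Some a :: v) u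
  else y (None :: v) (a :: u) - fill_sum xN v (a :: u).
have /choice[xS hS] : forall a, exists x, forall v u, in_range k.-1 n v u ->
    fill_sum x v u = yS a v u by move=> a; exact: IH.
exists (fun w =>
  if w is b :: w' then if b is Some a then xS a w' else xN w' else 0).
move=> v u /and4P[sv wv bv lv].
case: v sv wv bv lv => [//|[a|] v] /= sv wv bv lv.
  rewrite fill_sum_Some hS /yS ?ifT //; first by move: lv; rewrite /wt /=; lia.
  rewrite /in_range; move: sv wv bv lv => /=; case: (ballot v) => //.
  by rewrite /wt /=; lia.
case: (ltnP (wt v) (n.+1 - k)) => lv'.
  have rN : in_range k n v u.
    rewrite /in_range; move: bv sv wv lv lv' => /=; case: (ballot v) => //.
    by rewrite /wt /=; lia.
  case: u wv rN => [|a u] wv rN; first by rewrite fill_sum_None0 hN // subr0.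
  rewrite fill_sum_None hN // hS /yS ?lv' ?subrK //.
  rewrite /in_range; move: bv sv wv lv lv' => /=; case: (ballot v) => //.
  by rewrite /wt /=; lia.
case: u wv => [|a u] wv; first by move: wv lv lv'; rewrite /wt /=; lia.
rewrite fill_sum_None hS /yS; first by rewrite ltnNge lv' /= addrC subrK.
rewrite /in_range; move: bv sv wv lv lv' => /=; case: (ballot v) => //.
by rewrite /wt /=; lia.
Qed.

End Words.

(** * Words as functions on positions *)

Section Positions.
Variable T : choiceType.
Implicit Types (v w : seq (option T)) (u : seq T).

Lemma mem_map_cons (b b' : option T) w (s : seq (seq (option T))) :
  (b :: w \in [seq b' :: w' | w' <- s]) = (b == b') && (w \in s).
Proof.
apply/mapP/andP => [[w' sw' [-> ->]]|[/eqP-> sw]]; first by rewrite eqxx.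
by exists w.
Qed.

(** The labels of [u] are consumed in the order in which the blanks of [V] occur. Keeping the list
    [r] of positions arbitrary lets the induction drop its head. *)
Lemma mem_fill_map (P : Type) (W V : P -> option T) r u :
  (map W r \in fill (map V r) u) =
  all (fun j => V j ==> (W j == V j)) r
  && (u == pmap W [seq j <- r | ~~ V j]).
Proof.
elim: r u => [|j r IH] [|a u] //=.
- case: (V j) => [b|] /=; rewrite mem_map_cons IH; first by rewrite andbA.
  by case: (W j) => [b|]; rewrite ?eqseqE ?andbF.
- case: (V j) => [b|] /=; first by rewrite mem_map_cons IH andbA.
  rewrite mem_cat !mem_map_cons !IH; case: (W j) => [b|] /=; last by rewrite orbF.
  have -> : (Some b == Some a) = (a == b) by rewrite eq_sym.
  by rewrite eqseq_cons andbCA.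
Qed.

Definition labels v : seq T := pmap id v.

Lemma fill_labels v u w : w \in fill v u -> perm_eq (labels w) (labels v ++ u).
Proof.
elim: v u w => [[|a u] w|[a|] v IH u w] /=; rewrite ?inE //.
- by move/eqP->.
- by case/mapP => w' /IH h ->; rewrite /= perm_cons.
case: u => [|a u].
  by case/mapP => w' /IH h ->.
rewrite mem_cat => /orP[] /mapP[w' /IH h ->] //=.
by rewrite perm_sym (perm_catCA (labels v) [:: a] u) /= perm_cons perm_sym.
Qed.

Lemma size_labels v : size (labels v) = wt v.
Proof. by rewrite /labels size_pmap. Qed.

Variable n : nat.

(* Positions are listed in decreasing order, so the head is position n - 1. *)
Definition word (W : nat -> option T) : seq (option T) := map W (rev (iota 0 n)).

Lemma size_word W : size (word W) = n.
Proof. by rewrite /word size_map size_rev size_iota. Qed.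

Lemma word_nth w : size w = n -> w = word (nth None (rev w)).
Proof.
move=> sw; rewrite /word map_rev -sw -size_rev map_nth_iota0 ?leqnn //.
by rewrite take_size revK.
Qed.

Lemma eq_word W V : (forall j, (j < n)%N -> W j = V j) -> word W = word V.
Proof.
move=> WV; apply/eq_in_map => j; rewrite mem_rev mem_iota; exact: WV.
Qed.

Lemma word_fillP (W V : nat -> option T) u :
  reflect ((forall j, (j < n)%N -> V j -> W j = V j) /\
           u = pmap W [seq j <- rev (iota 0 n) | ~~ V j])
          (word W \in fill (word V) u).
Proof.
rewrite /word mem_fill_map; apply: (iffP andP) => -[h /eqP ->]; split=> //.
- by move=> j jn Vj; apply/eqP/(implyP (allP h _ _)); rewrite ?mem_rev ?mem_iota.
- apply/allP => j; rewrite mem_rev mem_iota /= => jn; apply/implyP => Vj.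
  by rewrite h.
Qed.

End Positions.

(** The suffix of the word headed by position j has length j + 1 and carries exactly the letters at
    positions up to j. *)
Lemma ballotP (T : choiceType) n (V : nat -> option T) :
  reflect (forall j, (j < n)%N -> V j -> (2 * count V (iota 0 j.+1) <= j.+1)%N)
          (ballot (word n V)).
Proof.
have wtV m : wt (word m V) = count V (iota 0 m).
  by rewrite /wt /word count_map count_rev.
elim: n => [|n IH]; first by apply: ReflectT.
have -> : word n.+1 V = V n :: word n V.
  by rewrite /word -[n.+1]addn1 iotaD rev_cat.
have cS : V n -> count V (iota 0 n.+1) = (count V (iota 0 n)).+1.
  by rewrite -addn1 iotaD count_cat /= add0n => ->; rewrite addn1.
rewrite [ballot _]/= wtV size_word; apply: (iffP andP) => [[/IH h1 h2] j|h].
  rewrite ltnS leq_eqVlt => /orP[/eqP->|]; last exact: h1.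
  by move=> Vn; rewrite cS // (implyP h2).
split; first by apply/IH => j jn; apply: h; lia.
by apply/implyP => Vn; rewrite -cS // h.
Qed.

Lemma labels_nth_inj (T : choiceType) (w : seq (option T)) a j j' :
  uniq (labels w) -> nth None w j = Some a -> nth None w j' = Some a -> j = j'.
Proof.
have mem_nth_lab v i : nth None v i = Some a -> a \in labels v.
  by elim: v i => [|b v IH] [|i] //=; [move->; rewrite inE eqxx|
     case: b => [b|] /= /IH; rewrite ?inE => ->; rewrite ?orbT].
elim: w j j' => [|b w IH] [|j] [|j'] //=.
- by move=> /[swap] -> /= /andP[aw _] /mem_nth_lab; rewrite (negbTE aw).
- by move=> + /mem_nth_lab aw eb; rewrite eb /= aw.
- by case: b => [b|] /= => [/andP[_]|] /IH h /h e /e ->.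
Qed.

(** * Injections as words *)

Section FIWord.
Variables k n : nat.
Implicit Types f : FI k n.

Definition label_at f (j : nat) : option 'I_k := [pick i | f i == j :> nat].

Lemma label_atP f j i : label_at f j = Some i <-> f i = j :> nat.
Proof.
rewrite /label_at; case: pickP => [i' /eqP <-|h]; last first.
  by split=> // /eqP; rewrite h.
by split=> [[->]//|/ord_inj/FI_inj ->].
Qed.

Definition FI_word f := word n (label_at f).

Lemma FI_word_inj : injective FI_word.
Proof.
move=> f g /eq_in_map fg; apply/val_inj/ffunP => i; apply/ord_inj/esym.
apply/label_atP; rewrite -fg; first exact/label_atP.
by rewrite mem_rev mem_iota /= ltn_ord.
Qed.

Lemma FI_word_surj w :
  size w = n -> perm_eq (labels w) (enum 'I_k) -> exists f, w = FI_word f.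
Proof.
move=> sw pw; have uw : uniq (labels w) by rewrite (perm_uniq pw) enum_uniq.
have memw i : Some i \in rev w.
  have : i \in labels w by rewrite (perm_mem pw) mem_enum.
  by rewrite mem_rev /labels mem_pmap map_id.
have urw : uniq (labels (rev w)).
  by rewrite (perm_uniq (perm_pmap _ (permEl (perm_rev w)))).
have lt i : (index (Some i) (rev w) < n)%N by rewrite -sw -size_rev index_mem.
(* Reversal puts position 0 first, so the index of a label in [rev w] is its position. *)
pose F := [ffun i => Ordinal (lt i)].
have injF : injectiveb F.
  apply/injectiveP => i j; rewrite !ffunE => /(congr1 val) /= e.
  have := nth_index None (memw i); rewrite e nth_index //; by case.
exists (exist _ F injF); rewrite {1}(word_nth sw); apply: eq_word => j jn.
have FE i : (exist _ F injF : FI k n) i = index (Some i) (rev w) :> nat.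
  by rewrite /FI_fun /= ffunE.
case E : (nth None (rev w) j) => [i|].
  apply/esym/label_atP; rewrite FE; apply: labels_nth_inj (E) => //.
  exact: nth_index.
case E' : (label_at _ j) => [i|//].
by move/label_atP: E'; rewrite FE => e; rewrite -e nth_index in E.
Qed.

Definition FI_geq f : rel 'I_k := fun i j => (f j <= f i)%N.

(** Since [label_at f] is a partial inverse of [f], applying [f] to the labels recovers a sublist of
    the decreasing list of positions. *)
Lemma pmap_label_sorted f (P : pred nat) :
  sorted (FI_geq f) (pmap (label_at f) [seq j <- rev (iota 0 n) | P j]).
Proof.
set r := [seq _ <- _ | _].
have sr : sorted (fun a b => (b <= a)%N) r.
  rewrite sorted_filter; first by [].
    by move=> a b d /= h1 h2; apply: leq_trans h2 h1.
  by rewrite rev_sorted iota_sorted.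
have K : ocancel (label_at f) (fun i => f i : nat).
  by move=> j; case E : (label_at f j) => [i|//] /=; apply/label_atP.
have -> : FI_geq f = relpre (fun i => f i : nat) (fun a b => (b <= a)%N) by [].
rewrite -sorted_map (pmap_filter K) sorted_filter //.
by move=> a b d /= h1 h2; apply: leq_trans h2 h1.
Qed.

Lemma pmap_label_uniq f (P : pred nat) :
  uniq (pmap (label_at f) [seq j <- rev (iota 0 n) | P j]).
Proof.
have K : ocancel (label_at f) (fun i => f i : nat).
  by move=> j; case E : (label_at f j) => [i|//] /=; apply/label_atP.
by apply: (pmap_uniq K); rewrite filter_uniq ?rev_uniq ?iota_uniq.
Qed.

Lemma mem_pmap_label f (P : pred nat) i :
  (i \in pmap (label_at f) [seq j <- rev (iota 0 n) | P j]) = P (f i).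
Proof.
rewrite mem_pmap; apply/mapP/idP => [[j jr /esym/label_atP e]|Pi].
  by move: jr; rewrite -e mem_filter => /andP[].
exists (f i : nat); last by apply/esym/label_atP.
by rewrite mem_filter Pi mem_rev mem_iota /= ltn_ord.
Qed.

Lemma FI_geq_trans f : transitive (FI_geq f).
Proof. by move=> b a d h1 h2; apply: leq_trans h2 h1. Qed.

Lemma FI_geq_anti f : antisymmetric (FI_geq f).
Proof. by move=> i j; rewrite /FI_geq -eqn_leq => /eqP/ord_inj/FI_inj. Qed.

Lemma FI_word_wt f : wt (FI_word f) = k.
Proof.
have lE : labels (FI_word f) =
    pmap (label_at f) [seq j <- rev (iota 0 n) | predT j].
  by rewrite filter_predT /FI_word /word /labels; elim: (rev _) => //= j r ->.
rewrite -size_labels lE -[RHS]size_enum_ord; apply/perm_size/uniq_perm.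
- exact: pmap_label_uniq.
- exact: enum_uniq.
- by move=> i; rewrite mem_pmap_label mem_enum.
Qed.

End FIWord.

(** * Catalan sequences and ballot words *)

Section Catalan.
Variables (l n : nat) (c : Catalan l n).

Lemma Catalan_ltn (i j : 'I_l) : (i < j)%N -> (val c i < val c j)%N.
Proof.
by have /andP[/forallP/(_ i)/forallP/(_ j)/implyP + _] := valP c; apply.
Qed.

Lemma Catalan_ballot (i : 'I_l) : (2 * i.+1 <= (val c i).+1)%N.
Proof. by have /andP[_ /forallP/(_ i)] := valP c. Qed.

End Catalan.

(** A strictly increasing sequence is the sorted list of its image, so the image determines its
    length too; the dependent pair lets the two lengths differ a priori. *)
Lemma Catalan_codom_inj n l l' (c : Catalan l n) (c' : Catalan l' n) :
  codom (val c) =i codom (val c') ->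
  existT (fun l => Catalan l n) l c = existT (fun l => Catalan l n) l' c'.
Proof.
have sC m (d : Catalan m n) :
    sorted (fun a b : 'I_n => (a < b)%N) (codom (val d)).
  rewrite codomE; apply: (@homo_sorted _ _ (val d) (fun a b : 'I_m => (a < b)%N)).
    by move=> a b; exact: Catalan_ltn.
  have := iota_ltn_sorted 0 m; rewrite -val_enum_ord sorted_map; exact.
have tr : transitive (fun a b : 'I_n => (a < b)%N).
  by move=> a b d; exact: ltn_trans.
have ir : irreflexive (fun a b : 'I_n => (a < b)%N) by move=> a; exact: ltnn.
move=> /(irr_sorted_eq tr ir (sC _ _) (sC _ _)) e.
have ll' : l = l' by move/(congr1 size): (e); rewrite !size_codom !card_ord.
case: l' / ll' c' e => c'; rewrite !codomE => /eq_in_map e.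
by congr existT; apply/val_inj/ffunP => i; apply: e; rewrite mem_enum.
Qed.

Lemma ballot_Catalan (T : choiceType) n (V : nat -> option T) :
  ballot (word n V) ->
  exists l (c : Catalan l n),
    forall j : 'I_n, (j \in codom (val c)) = isSome (V j).
Proof.
move=> /ballotP bV; pose s := [seq j : 'I_n <- enum 'I_n | isSome (V j)].
have ss : sorted (fun a b : 'I_n => (a < b)%N) s.
  apply: sorted_filter; first by move=> a b d; exact: ltn_trans.
  by have := iota_ltn_sorted 0 n; rewrite -val_enum_ord sorted_map; exact.
pose c := [ffun i : 'I_(size s) => tnth (in_tuple s) i].
have cmono (i j : 'I_(size s)) : (i < j)%N -> (c i < c j)%N.
  move=> ij; rewrite !ffunE.
  have x0 : 'I_n := tnth (in_tuple s) i.
  rewrite !(tnth_nth x0) /=.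
  apply: (sorted_ltn_nth _ _ ss); rewrite ?inE // => a b d.
  exact: ltn_trans.
have cinj : injective c.
  move=> i j e.
  by case: (ltngtP i j) => [/cmono|/cmono|/ord_inj //]; rewrite e ltnn.
have codomc (j : 'I_n) : (j \in codom c) = isSome (V j).
  have -> : isSome (V j) = (j \in s) by rewrite mem_filter mem_enum andbT.
  apply/codomP/idP => [[i ->]|/(tnthP (in_tuple s))[i ei]].
    by rewrite ffunE (mem_tnth i (in_tuple s)).
  by exists i; rewrite ffunE ei.
have cP : [forall i : 'I_(size s), forall j : 'I_(size s),
      (i < j)%N ==> (c i < c j)%N]
    && [forall i : 'I_(size s), (2 * i.+1 <= (c i).+1)%N].
  apply/andP; split; first by apply/'forall_forallP => i j; apply/implyP/cmono.
  apply/forallP => i; have Vi : V (c i) by rewrite -codomc codom_f.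
  apply: leq_trans (bV _ (ltn_ord (c i)) Vi).
  (* The values of [c] at indices 0, ..., i are i + 1 distinct letter positions not beyond [c i], so
     i + 1 is at most the count bounded by [ballotP]. *)
  rewrite leq_mul2l -size_filter; apply/orP; right.
  have -> : i.+1 = size [seq (c i' : nat) | i' <- take i.+1 (enum 'I_(size s))].
    by rewrite size_map size_takel // size_enum_ord ltn_ord.
  apply: uniq_leq_size.
    rewrite map_inj_uniq; first by rewrite take_uniq ?enum_uniq.
    by move=> a b /ord_inj/cinj.
  move=> a /mapP[i']; rewrite in_take ?mem_enum // index_enum_ord ltnS => ii' ->.
  rewrite mem_filter -codomc codom_f mem_iota /= add0n ltnS.
  by move: ii'; rewrite leq_eqVlt => /orP[/eqP/ord_inj->|/cmono/ltnW].
by exists (size s), (exist _ c cP).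
Qed.

(** * Codes of the components of the embedding spaces *)

Section Code.
Variables (R : realType) (k l n : nat) (c : Catalan l n).
Implicit Types (phi psi : EmbC R k c) (f : FI k n).

Lemma inXneqY (x : im c) (s : R) : inX x <> inY s :> target R c.
Proof. by move=> /(congr1 (@tag _ _)). Qed.

Lemma inY_inj (s t : R) : inY s = inY t :> target R c -> s = t.
Proof. by move=> /(congr1 (@coordY R l n c)). Qed.

Lemma coordY_inY (s : R) : coordY (inY s : target R c) = s.
Proof. by []. Qed.

Lemma phi_inj phi : injective (val phi : 'I_k -> target R c).
Proof. by have [] := set_mem (valP phi). Qed.

Lemma phi_cover phi (x : im c) : exists i, val phi i = inX x.
Proof. by have [_] := set_mem (valP phi); apply. Qed.

Lemma im_codom (x : im c) : val x \in codom (val c).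
Proof. exact: (valP (x : {x : 'I_n | x \in codom (val c)})). Qed.

Variant emb_val_spec (z : target R c) : Type :=
  | EmbX (x : im c) of z = inX x
  | EmbY (s : R) of z = inY s.

Lemma emb_valP z : emb_val_spec z.
Proof. by case: z => [[] x]; [exact: (@EmbX _ x)|exact: (@EmbY _ x)]. Qed.

Definition im_label phi (j : nat) : option 'I_k :=
  [pick i | `[< exists2 x : im c, val phi i = inX x & val x = j :> nat >]].

Lemma im_labelP phi j i :
  im_label phi j = Some i <->
  exists2 x : im c, val phi i = inX x & val x = j :> nat.
Proof.
rewrite /im_label; case: pickP => [i' /asboolP[x' e' ej']|h]; last first.
  by split=> // H; have := h i; rewrite (asboolT H).
split=> [[<-]|[x e ej]]; first by exists x'.
have xx' : x = x' by apply/val_inj/ord_inj; rewrite ej ej'.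
by congr Some; apply: (phi_inj (phi := phi)); rewrite /= e e' xx'.
Qed.

Lemma im_label_codom phi (j : 'I_n) :
  isSome (im_label phi j) = (j \in codom (val c)).
Proof.
apply/idP/idP => [|jc].
  case E : (im_label phi j) => [i|//] _; move/im_labelP: E => [x _ /ord_inj <-].
  exact: im_codom.
have [i e] := phi_cover phi (exist _ j jc : im c).
by have /im_labelP -> : exists2 x : im c, val phi i = inX x & val x = j :> nat
  by exists (exist _ j jc : im c).
Qed.

Definition isY phi i := ~~ tag (val phi i).

(** The order is decreasing because [word] lists positions from the greatest down. *)
Definition line_labels phi : seq 'I_k :=
  sort (fun i j => coordY (val phi j) <= coordY (val phi i))
       [seq i <- enum 'I_k | isY phi i].

Lemma isYP phi i : reflect (exists s, val phi i = inY s) (isY phi i).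
Proof.
rewrite /isY; case: (emb_valP (val phi i)) => [x|s] e; rewrite e /=.
  by apply: ReflectF => -[s /inXneqY].
by apply: ReflectT; exists s.
Qed.

Lemma mem_line_labels phi i : (i \in line_labels phi) = isY phi i.
Proof. by rewrite mem_sort mem_filter mem_enum andbT. Qed.

Lemma uniq_line_labels phi : uniq (line_labels phi).
Proof. by rewrite sort_uniq filter_uniq ?enum_uniq. Qed.

Lemma line_labels_sorted phi :
  sorted (fun i j => coordY (val phi j) <= coordY (val phi i)) (line_labels phi).
Proof. by apply: sort_sorted => i j; exact: le_total. Qed.

Definition im_word phi := word n (im_label phi).

(** Agreement on the letters is matching on im c. On the line, both lists have the same members
    without repetition, so they coincide exactly when [f] orders the labels as the real coordinates
    do. *)
Lemma matches_fillP f phi :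
  reflect (matches f phi) (FI_word f \in fill (im_word phi) (line_labels phi)).
Proof.
apply: (iffP (word_fillP _ _ _ _)) => [[hX hY]|[m1 m2]].
  have fX i (x : im c) : val phi i = inX x -> f i = val x.
    move=> e; have E : im_label phi (val x) = Some i by apply/im_labelP; exists x.
    by apply/ord_inj/label_atP; rewrite hX ?E.
  split=> // i j s t ei ej.
  have fY i' j' s' t' : val phi i' = inY s' -> val phi j' = inY t' -> s' < t' ->
      (f i' < f j')%N.
    move=> ei' ej' st.
    have mi : i' \in line_labels phi.
      by rewrite mem_line_labels; apply/isYP; exists s'.
    have mj : j' \in line_labels phi.
      by rewrite mem_line_labels; apply/isYP; exists t'.
    have sdec : sorted (FI_geq f) (line_labels phi).
      by rewrite hY pmap_label_sorted.
    have rdec : reflexive (FI_geq f) by move=> a; exact: leqnn.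
    have : FI_geq f j' i'.
      apply: (sorted_leq_index (@FI_geq_trans _ _ f) rdec sdec) => //.
      rewrite leqNgt; apply/negP => /ltnW h.
      suff : coordY (val phi j') <= coordY (val phi i').
        by rewrite ei' ej' !coordY_inY leNgt st.
      apply: (sorted_leq_index _ _ (line_labels_sorted phi)) => //.
      by move=> a b d /= h1 h2; apply: le_trans h2 h1.
    rewrite /FI_geq leq_eqVlt => /orP[/eqP/ord_inj/FI_inj e|//].
    by move: ei' st; rewrite e ej' => /inY_inj ->; rewrite ltxx.
  split=> [fij|]; last exact: fY.
  case: (ltgtP s t) => // [ts|st].
    by have := fY _ _ _ _ ej ei ts; rewrite ltnNge ltnW.
  by move: ej; rewrite -st -ei => /phi_inj e; rewrite e ltnn in fij.
split.
  move=> j jn; case E : (im_label phi j) => [i|//] _.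
  by move/im_labelP: E => [x /m1 e <-]; apply/label_atP; rewrite e.
have mE i : (i \in pmap (label_at f)
      [seq j <- rev (iota 0 n) | ~~ im_label phi j]) = isY phi i.
  rewrite (mem_pmap_label f (fun j => ~~ im_label phi j)) im_label_codom.
  case: (emb_valP (val phi i)) => [x|s] e.
    rewrite (m1 _ _ e) im_codom.
    by apply/esym/isYP => -[s]; rewrite e => /inXneqY.
  have -> : isY phi i by apply/isYP; exists s.
  apply/negP => fc; have [i' e'] := phi_cover phi (exist _ (f i) fc : im c).
  have /FI_inj ii' := m1 _ _ e'; by move: e'; rewrite ii' e => /esym/inXneqY.
apply: (sorted_eq (@FI_geq_trans _ _ f) (@FI_geq_anti _ _ f)).
- apply: sub_in_sorted (line_labels_sorted phi); last first.
    by apply/allP => i; rewrite mem_line_labels; exact: id.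
  move=> i j /isYP[s ei] /isYP[t ej] /=; rewrite ei ej !coordY_inY => ts.
  by rewrite /FI_geq leqNgt; apply/negP => /(m2 _ _ _ _ ei ej); rewrite ltNge ts.
- exact: pmap_label_sorted.
- apply: uniq_perm; [exact: uniq_line_labels|exact: pmap_label_uniq|].
  by move=> i; rewrite mE mem_line_labels.
Qed.

Lemma im_word_labels phi :
  perm_eq (labels (im_word phi) ++ line_labels phi) (enum 'I_k).
Proof.
have memL i : (i \in labels (im_word phi)) = ~~ isY phi i.
  rewrite /labels /im_word /word mem_pmap map_id.
  case: (emb_valP (val phi i)) => [x|s] e.
    have -> : isY phi i = false by apply/isYP => -[s]; rewrite e => /inXneqY.
    apply/mapP; exists (val x : nat); first by rewrite mem_rev mem_iota /= ltn_ord.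
    by apply/esym/im_labelP; exists x.
  have -> : isY phi i by apply/isYP; exists s.
  by apply/mapP => -[j _ /esym/im_labelP[x]]; rewrite e => /esym/inXneqY.
apply: uniq_perm; rewrite ?enum_uniq //.
  rewrite cat_uniq uniq_line_labels andbT; apply/andP; split; last first.
    by apply/hasPn => i; rewrite mem_line_labels memL => ->.
  (* A one-sided inverse of [im_label phi], used only to get uniqueness; the default 0 concerns
     labels on the line, which [im_label phi] never returns. *)
  pose pos i := if [pick x : {x : 'I_n | x \in codom (val c)} |
     `[< val phi i = inX (x : im c) >]] is Some x then val x : nat else 0%N.
  have K : ocancel (im_label phi) pos.
    move=> j; case E : (im_label phi j) => [i|//] /=.
    move/im_labelP: E => [x e <-]; rewrite /pos.
    case: pickP => [y /asboolP|/(_ x) /asboolP //].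
    by rewrite e => /inX_inj ->.
  have -> : labels (im_word phi) = pmap (im_label phi) (rev (iota 0 n)).
    by rewrite /im_word /word; elim: (rev _) => //= j r ->.
  by apply: (pmap_uniq K); rewrite rev_uniq iota_uniq.
by move=> i; rewrite mem_cat mem_enum memL mem_line_labels orNb.
Qed.

Lemma im_word_ballot phi : ballot (im_word phi).
Proof.
apply/ballotP => j jn.
rewrite -[j]/(val (Ordinal jn)) im_label_codom => /codomP[i eji].
have ej : j = val c i :> nat by rewrite -eji.
apply: leq_trans (_ : (2 * i.+1 <= _)%N); last by rewrite eji Catalan_ballot.
(* As [c] is strictly increasing, the letters at positions up to [c i] sit at values [c i'] with i'
   <= i, so there are at most i + 1 of them. *)
rewrite leq_mul2l -size_filter; apply/orP; right.
have -> : i.+1 = size [seq (val c i' : nat) | i' <- take i.+1 (enum 'I_l)].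
  by rewrite size_map size_takel // size_enum_ord ltn_ord.
apply: uniq_leq_size; first by rewrite filter_uniq ?iota_uniq.
move=> a; rewrite mem_filter mem_iota /= add0n ltnS => /andP[+ aj].
have an : (a < n)%N by lia.
rewrite -[a]/(val (Ordinal an)) im_label_codom => /codomP[i' /(congr1 val)/= ei'].
apply/mapP; exists i' => //.
rewrite in_take ?mem_enum // index_enum_ord ltnS leqNgt.
by apply/negP => /(@Catalan_ltn _ _ c); rewrite -ej -ei' ltnNge aj.
Qed.

(** The truncation is vacuous here: a weight of at most k - 1 is at most n - k because n >= 2k - 1,
    and weight k forces n >= 2k by the ballot bound. *)
Lemma im_word_range phi : (2 * k - 1 <= n)%N ->
  in_range k n (im_word phi) (line_labels phi).
Proof.
move=> kn; have := perm_size (im_word_labels phi).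
rewrite size_cat size_labels size_enum_ord => e.
have b := im_word_ballot phi; have := ballot_wt b.
by rewrite /in_range b e eqxx size_word eqxx /=; lia.
Qed.

(** Labels with [f i] in im c keep this value; every other label goes to the real number [f i], so
    the order on the line is that of [f]. *)
Lemma matches_emb_exists f :
  (forall x, x \in codom (val c) -> exists i, f i = x) ->
  exists phi, matches f phi.
Proof.
move=> cf.
pose g (i : 'I_k) : target R c :=
  if insub (f i) is Some x then inX (x : im c) else inY ((f i)%:R : R).
have gX i (x : im c) : g i = inX x -> f i = val x.
  by rewrite /g; case: insubP => [y _ <- /inX_inj -> //|_ /esym/inXneqY].
have gY i s : g i = inY s -> s = (f i)%:R.
  by rewrite /g; case: insubP => [y _ _ /inXneqY //|_ /inY_inj].
have gP : (g : {ptws 'I_k -> target R c}) \in EmbC R k c.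
  apply/mem_set; split=> [i j|x].
    case: (emb_valP (g i)) => [x|s] e; rewrite e => /esym e'.
      by apply: (@FI_inj _ _ f); rewrite (gX _ _ e) (gX _ _ e').
    move: (gY _ _ e) (gY _ _ e') => -> /eqP.
    by rewrite eqr_nat => /eqP/ord_inj/FI_inj.
  have [i fi] := cf _ (im_codom x).
  exists i; rewrite /g; case: insubP => [y _ ey|]; last by rewrite fi im_codom.
  by congr inX; apply: val_inj; rewrite ey fi.
exists (exist (fun x => x \in EmbC R k c) (g : {ptws 'I_k -> target R c}) gP).
split=> /=; first exact: gX.
by move=> i j s t /gY -> /gY ->; rewrite ltr_nat.
Qed.

Lemma matches_inX f phi psi i x : matches f phi -> matches f psi ->
  val phi i = inX x -> val psi i = inX x.
Proof.
move=> [m1 _] [m2 _] e; have [i' e'] := phi_cover psi x.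
by have /FI_inj <- : f i' = f i by rewrite (m1 _ _ e) (m2 _ _ e').
Qed.

(* Two embeddings matched by f have the same values in im c, and their real
   coordinates are in the same order, so the straight-line homotopy of these
   coordinates stays injective; [clampR] extends it to the whole line. *)
Lemma matches_joined_uniq f phi psi :
  matches f phi -> matches f psi -> joined R phi psi.
Proof.
move=> m m'.
pose g (t : R) (i : 'I_k) : target R c :=
  if isY phi i then
    inY (coordY (val phi i) + t * (coordY (val psi i) - coordY (val phi i)))
  else val phi i.
have bothY i s : val phi i = inY s -> exists t, val psi i = inY t.
  move=> e; case: (emb_valP (val psi i)) => [x e'|t ->]; last by exists t.
  by have := matches_inX m' m e'; rewrite e => /esym/inXneqY.
have g0 : g 0 = val phi.
  apply/funext => i; rewrite /g mul0r addr0; case: ifP => // /isYP[s ->].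
  by rewrite coordY_inY.
have g1 : g 1 = val psi.
  apply/funext => i; rewrite /g mul1r addrC subrK.
  case: ifP => [/isYP[s /bothY[t ->]]|]; first by rewrite coordY_inY.
  case: (emb_valP (val phi i)) => [x e _|s e /isYP[]]; last by exists s.
  by rewrite e (matches_inX m m' e).
have glt s i j a b a' b' : 0 <= s <= 1 ->
    val phi i = inY a -> val phi j = inY b ->
    val psi i = inY a' -> val psi j = inY b' -> (f i < f j)%N ->
    a + s * (a' - a) < b + s * (b' - b).
  move=> /andP[s0 s1] ei ej ei' ej' fij.
  have ab : a < b by apply/(m.2 _ _ _ _ ei ej).
  have ab' : a' < b' by apply/(m'.2 _ _ _ _ ei' ej').
  have E x x' : x + s * (x' - x) = (1 - s) * x + s * x' by ring.
  rewrite !E.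
  (* For s < 1 the first summand gives strictness; at s = 1 its weight is zero and the second one
     decides. *)
  have [s_lt1|s_ge1] := ltP s 1.
    apply: ltr_leD; first by rewrite ltr_pM2l // subr_gt0.
    by rewrite ler_wpM2l // ltW.
  have -> : s = 1 by apply: le_anti; rewrite s1 s_ge1.
  by rewrite subrr !mul0r !add0r !mul1r.
have ginj s : 0 <= s <= 1 -> injective (g s).
  move=> s01 i j; rewrite /g.
  case: (boolP (isY phi i)) => iY; case: (boolP (isY phi j)) => jY.
  - move: iY jY => /isYP[a ei] /isYP[b ej].
    have [a' ei'] := bothY _ _ ei; have [b' ej'] := bothY _ _ ej.
    rewrite ei ej ei' ej' !coordY_inY => /inY_inj e.
    case: (ltngtP (f i) (f j)) => [fij|fji|/ord_inj/FI_inj //].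
      by have := glt _ _ _ _ _ _ _ s01 ei ej ei' ej' fij; rewrite e ltxx.
    by have := glt _ _ _ _ _ _ _ s01 ej ei ej' ei' fji; rewrite e ltxx.
  - by move=> e; case/negP: jY; apply/isYP; rewrite -e; eexists.
  - by move=> e; case/negP: iY; apply/isYP; rewrite e; eexists.
  - exact: phi_inj.
have gP t : (g (clampR t) : {ptws 'I_k -> target R c}) \in EmbC R k c.
  apply/mem_set; split=> [|x]; first by apply: ginj; rewrite -unit_itvP clampR_itv.
  have [i e] := phi_cover phi x; exists i; rewrite /g ifF ?e //.
  by apply/isYP => -[s]; rewrite e => /inXneqY.
apply/joinedP; exists (fun t => exist (fun x => x \in EmbC R k c)
  (g (clampR t) : {ptws 'I_k -> target R c}) (gP t)); split; first last.
- by apply: val_inj; rewrite /= clampR_id ?lexx ?ler01.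
- by apply: val_inj; rewrite /= clampR_id ?lexx ?ler01.
apply: (@continuous_comp_initial _ _ _ (@set_val _ (EmbC R k c))).
apply: ptws_continuous => i.
have cl : continuous (@clampR R).
  move=> t; apply: (@continuous_comp _ _ _ (@clamp R) (val : unit_itv R -> R)).
    exact: clamp_continuous.
  exact: val_unit_itv_continuous.
rewrite [X in continuous X](_ : _ = fun t => g (clampR t) i) // /g.
case: (isY phi i); last by move=> t; exact: cvg_cst.
move=> t; apply: (@continuous_comp _ _ _ (fun t : R => coordY (val phi i)
   + clampR t * (coordY (val psi i) - coordY (val phi i))) (@inY (im c) R)).
  apply: cvgD; first exact: cvg_cst.
  by apply: cvgM; [exact: cl|exact: cvg_cst].
exact: (@existT_continuous _ (coprod_fam (im c) R) false).
Qed.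

End Code.

(** * The homomorphism chi *)

Section Pairing.
Variables (R : realType) (k n : nat).
Implicit Types (p : CB R k n) (f : FI k n).

Lemma CBP p : exists l (c : Catalan l n) (phi : EmbC R k c), p = CB_class phi.
Proof.
case: p => l [c q]; exists l, c, (repr q).
by rewrite /CB_class reprK.
Qed.

Definition matchb f p : bool :=
  let: existT _ (existT _ q) := p in `[< matches f (repr q) >].

Lemma pairingE f p : pairing f p = (matchb f p)%:R.
Proof. by case: p => l [c q]. Qed.

Lemma matchb_class f l (c : Catalan l n) (phi : EmbC R k c) :
  matchb f (CB_class phi) = `[< matches f phi >].
Proof.
have := pairing_class f phi; rewrite pairingE.
by case: (matchb _ _); case: `[< _ >].
Qed.

Definition im_set p : {set 'I_n} :=
  let: existT _ (existT c _) := p in [set j in codom (val c)]%SET.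

(** Equal images force equal Catalan sequences, and two embeddings matched by the same [f] are
    joined by the straight-line homotopy. *)
Lemma matchb_uniq f p q :
  matchb f p -> matchb f q -> im_set p = im_set q -> p = q.
Proof.
have [l [c [phi ->]]] := CBP p; have [l' [c' [psi ->]]] := CBP q.
rewrite !matchb_class => /asboolP mp /asboolP mq /= im.
have /Catalan_codom_inj : codom (val c) =i codom (val c').
  by move=> j; have := congr1 (fun A : {set 'I_n} => j \in A) im; rewrite !inE.
set d := existT _ l c; set d' := existT _ l' c' => e.
(* The type of [psi] depends on the pair, so the claim is generalised over it before rewriting along
   [e]. *)
pose Q (d' : {l & Catalan l n}) := forall psi : EmbC R k (tagged d'),
  matches f psi -> CB_class phi = CB_class psi.
suff : Q d' by move/(_ psi); exact.
rewrite -e => psi' mpsi'.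
rewrite /CB_class.
have -> : \pi_(CBc R k c) phi = \pi_(CBc R k c) (psi' : EmbC R k c).
  by apply/eqmodP; exact: matches_joined_uniq mp mpsi'.
by [].
Qed.

(** On the classes matched by [f], [im_set] is injective, with values in the finite type of subsets
    of ['I_n]. *)
Lemma finite_matchb f : finite_set [set p | matchb f p].
Proof.
rewrite -(@eq_finite_set _ _ (im_set @` [set p | matchb f p])).
  exact: finite_finset.
apply: inj_card_eq => p q /set_mem /= mp /set_mem /= mq.
exact: matchb_uniq mp mq.
Qed.

Lemma chiU_sum f : exists2 s : seq (CB R k n),
  uniq s /\ s =i [pred p | matchb f p] & chi R << f >> = \sum_(p <- s) << p >>.
Proof.
have /finite_seqP[s es] := finite_matchb f.
have ms q : (q \in undup s) = matchb f q.
  rewrite mem_undup; have := congr1 (fun A => A q) es; rewrite /= => e.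
  by apply/idP/idP; rewrite e.
exists (undup s); first by rewrite undup_uniq.
rewrite /chi liftU scale1r (fsbigE (undup s)) ?undup_uniq //; last first.
  by move=> q _; rewrite ms pairingE => /negbTE->; rewrite scale0r.
rewrite (eq_bigl xpredT); last by move=> q; rewrite in_setT.
by apply: eq_big_seq => q; rewrite ms pairingE => ->; rewrite scale1r.
Qed.

Lemma coeff_chiU f p : coeff p (chi R << f >>) = (matchb f p)%:R.
Proof.
have [s [us ms] ->] := chiU_sum f; rewrite raddf_sum /=.
case: (boolP (matchb f p)) => mp.
  rewrite (bigD1_seq p) ?us ?ms //= coeffU eqxx big1 ?addr0 // => q qp.
  by rewrite coeffU (negbTE qp).
rewrite big1_seq // => q /andP[_]; rewrite ms coeffU; case: eqP => [->|//].
by rewrite inE (negbTE mp).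
Qed.

Lemma chi_is_zmod_morphism : zmod_morphism (@chi R k n).
Proof. exact: lift_is_additive. Qed.

HB.instance Definition _ := GRing.isZmodMorphism.Build (ZFI k n) (ZCB R k n)
  (@chi R k n) chi_is_zmod_morphism.

Lemma coeff_chi x p :
  coeff p (chi R x) = \sum_(f <- dom x) coeff f x * (matchb f p)%:R.
Proof.
rewrite -[x in LHS]freeg_sumE raddf_sum /= raddf_sum /=; apply: eq_bigr => f _.
have -> : chi R << coeff f x *g f >> = coeff f x *: chi R << f >>.
  by rewrite /chi !liftU scale1r.
by rewrite coeffZ coeff_chiU.
Qed.

Definition code_im p : seq (option 'I_k) :=
  let: existT _ (existT _ q) := p in im_word (repr q).
Definition code_line p : seq 'I_k :=
  let: existT _ (existT _ q) := p in line_labels (repr q).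

Lemma matchb_fill f p :
  matchb f p = (FI_word f \in fill (code_im p) (code_line p)).
Proof. by case: p => l [c q]; apply/asboolP/matches_fillP. Qed.

Lemma code_range p : (2 * k - 1 <= n)%N -> in_range k n (code_im p) (code_line p).
Proof. by case: p => l [c q]; exact: im_word_range. Qed.

Lemma code_fill_surj p w :
  w \in fill (code_im p) (code_line p) -> exists f, w = FI_word f.
Proof.
case: p => l [c q] /= wf; apply: FI_word_surj.
  by have [-> _] := fill_size_wt wf; rewrite size_word.
by apply: perm_trans (fill_labels wf) _; exact: im_word_labels.
Qed.

(** The bound gives k <= n, so the common code has a filling; it is the word of some [f], which then
    matches both classes, and equal letter positions give equal images. *)
Lemma code_inj : (2 * k - 1 <= n)%N ->
  forall p q, code_im p = code_im q -> code_line p = code_line q -> p = q.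
Proof.
move=> kn p q e1 e2; have [] := @fill_neq0 _ (code_im p) (code_line p).
  by have /and4P[/eqP-> /eqP-> _ _] := code_range p kn; lia.
move=> w wf; have [f ef] := code_fill_surj wf; rewrite ef in wf.
apply: (@matchb_uniq f); rewrite ?matchb_fill -?e1 -?e2 //.
case: p q e1 {e2 wf} => l [c p] [l' [c' q]] /= /eq_in_map e.
apply/setP => j; rewrite !inE.
rewrite -(im_label_codom (repr p)) -(im_label_codom (repr q)).
by rewrite e // mem_rev mem_iota /= ltn_ord.
Qed.

End Pairing.

(** * Bijectivity of [chi] from the linear system on words *)

Lemma sum_coeff_inj (K : choiceType) (T : eqType) (h : K -> T)
    (x : {freeg K / int}) a :
  injective h -> \sum_(b <- dom x) coeff b x * (h b == h a)%:R = coeff a x.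
Proof.
move=> hi; case: (boolP (a \in dom x)) => ax.
  rewrite (bigD1_seq a ax (uniq_dom x)) /= eqxx mulr1 big1 ?addr0 // => b ba.
  by rewrite (inj_eq hi) (negbTE ba) mulr0.
rewrite (coeff_outdom ax) big1_seq // => b /andP[_ bx]; rewrite (inj_eq hi).
by case: eqP bx => [->|_ _]; rewrite ?mulr0 // (negbTE ax).
Qed.

HB.instance Definition _ k n := [Finite of FI k n by <:].

Section Bijectivity.
Variables (R : realType) (k n : nat).
Implicit Types (p : CB R k n) (f : FI k n).

(** The letter positions of [v] give the Catalan sequence, and [f] itself supplies an embedding with
    code (v, u). *)
Lemma code_class f v u : FI_word f \in fill v u -> ballot v ->
  exists p : CB R k n, forall f', matchb f' p = (FI_word f' \in fill v u).
Proof.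
move=> wf bv; have sv : size v = n.
  by have [<- _] := fill_size_wt wf; rewrite size_word.
move: wf bv; rewrite (word_nth sv); set V := nth None (rev v) => wf bv.
have [l [c cV]] := ballot_Catalan bv.
have [h1 h2] := elimT (word_fillP _ _ _ _) wf.
have [|phi mphi] := @matches_emb_exists R k l n c f.
  move=> x; rewrite cV; case E : (V x) => [i|//] _; exists i.
  by apply/ord_inj/label_atP; rewrite h1 ?E.
have eV j : (j < n)%N -> im_label phi j = V j.
  move=> jn; have := im_label_codom phi (Ordinal jn); rewrite cV /=.
  case Ei : (im_label phi j) => [i|]; case EV : (V j) => [i'|] //= _.
  congr Some; move/im_labelP: Ei => [x /(mphi.1) fi ej].
  have : f i' = j :> nat by apply/label_atP; rewrite h1 ?EV.
  by rewrite -ej -fi => /ord_inj/FI_inj.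
have ew : im_word phi = word n V by exact: eq_word.
have eu : line_labels phi = u.
  have [_ ->] := elimT (word_fillP _ _ _ _) (introT (matches_fillP f phi) mphi).
  rewrite h2; congr pmap; apply: eq_in_filter => j; rewrite mem_rev mem_iota => jn.
  by rewrite eV.
exists (CB_class phi) => f'; rewrite matchb_class -ew -eu.
by apply/asboolP/matches_fillP.
Qed.

Lemma chi_inj : (2 * k - 1 <= n)%N -> injective (@chi R k n).
Proof.
move=> kn; apply: raddf_inj => x x0.
(* The coefficients of [x] carried over to words, zero on words that come from no injection. *)
pose xw w : int := \sum_(f <- dom x) coeff f x * (FI_word f == w)%:R.
have sum_xw v u : fill_sum xw v u =
    \sum_(f <- dom x) coeff f x * (FI_word f \in fill v u)%:R.
  rewrite /fill_sum /xw exchange_big /=; apply: eq_bigr => f _.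
  rewrite -mulr_sumr; congr (_ * _).
  case: (boolP (_ \in _)) => wf.
    rewrite (bigD1_seq (FI_word f)) ?fill_uniq //= eqxx big1 ?addr0 // => w wn.
    by rewrite eq_sym (negbTE wn).
  rewrite big1_seq // => w /andP[_ wv].
  by case: eqP => // e; rewrite -e (negbTE wf) in wv.
have xw0 : forall w, size w = n -> wt w = k -> xw w = 0.
  apply: fill_sum_inj => v u /and4P[sv wv bv lv]; rewrite sum_xw.
  (* A code in range may repeat labels and then belongs to no class. If no word from the support of
     [x] fills it, its sum has only zero terms; otherwise it is realised and its sum is a
     coefficient of [chi R x]. *)
  case: (boolP (has (fun f => FI_word f \in fill v u) (dom x)))
    => [/hasP[f _ wf]|/hasPn nf].
    have [p hp] := code_class wf bv.
    rewrite -[RHS](_ : coeff p (chi R x) = 0); last by rewrite x0 raddf0.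
    by rewrite coeff_chi; apply: eq_bigr => f' _; rewrite hp.
  by rewrite big1_seq // => f /andP[_ /nf/negbTE->]; rewrite mulr0.
apply/eqP/freeg_eqP => f; rewrite raddf0.
have := xw0 _ (size_word _ _) (FI_word_wt f).
by rewrite /xw (sum_coeff_inj _ _ (@FI_word_inj k n)).
Qed.

Lemma chi_surj : (2 * k - 1 <= n)%N ->
  forall y : ZCB R k n, exists x, chi R x = y.
Proof.
move=> kn y.
pose Y v u : int :=
  \sum_(p <- dom y) coeff p y * ((code_im p, code_line p) == (v, u))%:R.
have YE p : Y (code_im p) (code_line p) = coeff p y.
  apply: (sum_coeff_inj (h := fun p => (code_im p, code_line p))) => q q' [].
  exact: code_inj.
have [x hx] := fill_sum_surj n k Y.
(* The solution lives on all words. Restricting it to words of injections keeps the sums for actual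
   classes, since all fillings of their codes are such words. *)
exists (\sum_(f : FI k n) << x (FI_word f) *g f >> : ZFI k n).
apply/eqP/freeg_eqP => p; rewrite raddf_sum /= raddf_sum /=.
rewrite -YE -hx; last exact: code_range.
have pF : perm_eq (fill (code_im p) (code_line p))
    [seq FI_word f | f <- index_enum (FI k n) & matchb f p].
  apply: uniq_perm; first exact: fill_uniq.
    by rewrite map_inj_uniq ?filter_uniq ?index_enum_uniq //; exact: FI_word_inj.
  move=> w; apply/idP/mapP => [wf|[f]].
    have [f ef] := code_fill_surj wf; exists f => //.
    by rewrite mem_filter mem_index_enum andbT matchb_fill -ef.
  by rewrite mem_filter matchb_fill => /andP[+ _] ->.
rewrite /fill_sum (perm_big _ pF) big_map big_filter [RHS]big_mkcond /=.
apply: eq_bigr => f _.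
have -> : chi R << x (FI_word f) *g f >> = x (FI_word f) *: chi R << f >>.
  by rewrite /chi !liftU scale1r.
by rewrite coeffZ coeff_chiU; case: (matchb _ _); rewrite ?mulr1 ?mulr0.
Qed.

Lemma chi_bij : (2 * k - 1 <= n)%N -> bijective (@chi R k n).
Proof.
move=> kn; have [g gK] := choice (chi_surj kn).
by exists g => // x; apply: (chi_inj kn); rewrite gK.
Qed.

End Bijectivity.

(** * Compatibility of [chi] with precomposition *)

Section Equivariance.
Variables (R : realType) (k k' n : nat) (g : FI k' k).
Implicit Types (f : FI k n).

Lemma actCB_zmod : zmod_morphism (@actCB R k' k n g).
Proof. exact: lift_is_additive. Qed.

Lemma actFI_zmod : zmod_morphism (@actFI k' k n g).
Proof. exact: lift_is_additive. Qed.

HB.instance Definition _ := GRing.isZmodMorphism.Build (ZCB R k n) (ZCB R k' n)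
  (@actCB R k' k n g) actCB_zmod.
HB.instance Definition _ := GRing.isZmodMorphism.Build (ZFI k n) (ZFI k' n)
  (@actFI k' k n g) actFI_zmod.

Lemma FI_compE f i : FI_comp f g i = f (g i).
Proof. by rewrite /FI_comp /FI_fun SubK ffunE. Qed.

(** A nonzero restriction keeps its image and is matched by the composite, hence is the unique such
    class. Conversely, a class with this image matched by the composite shows that im c stays
    covered after [g], so the restriction is nonzero. *)
Lemma coeff_actCB f (p : CB R k n) (q : CB R k' n) : matchb f p ->
  coeff q (actCB R g << p >>) =
  (matchb (FI_comp f g) q && (im_set p == im_set q))%:R.
Proof.
have [l [c [phi ->]]] := CBP p; rewrite matchb_class => /asboolP[m1 m2].
rewrite actCB_class; case E : (restr phi g) => [psi|].
  have ev i : val psi i = val phi (g i) by rewrite (val_restr E).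
  have mpsi : matchb (FI_comp f g) (CB_class psi).
    rewrite matchb_class; apply/asboolP; split=> [i x|i j s t].
      by rewrite ev FI_compE; exact: m1.
    by rewrite !ev !FI_compE; exact: m2.
  rewrite coeffU mul1r; congr ((nat_of_bool _)%:R).
  apply/eqP/andP => [<-|[mq /eqP im]]; first by rewrite mpsi /=.
  exact: (matchb_uniq mpsi mq).
rewrite raddf0; case: (boolP (_ && _)) => // /andP[].
have [l' [c' [psi ->]]] := CBP q.
rewrite matchb_class => /asboolP[m1' _] /eqP ims.
suff /isSome_restr : forall x : im c, exists i, val phi (g i) = inX x by rewrite E.
move=> x; have xc : (val x : 'I_n) \in codom (val c').
  move/setP/(_ (val x)): ims; rewrite !inE => <-.
  exact: im_codom.
have [i e] := phi_cover psi (exist _ (val x) xc : im c').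
have [i0 e0] := phi_cover phi x; exists i; rewrite -e0; congr (val phi _).
by apply: (@FI_inj _ _ f); rewrite (m1 _ _ e0) -FI_compE (m1' _ _ e).
Qed.

Lemma chi_actU f : chi R << FI_comp f g >> = actCB R g (chi R << f >>).
Proof.
apply/eqP/freeg_eqP => q; rewrite coeff_chiU.
have [s [us ms] ->] := chiU_sum R f.
rewrite raddf_sum /= raddf_sum /=.
rewrite (eq_big_seq (fun p =>
  (matchb (FI_comp f g) q && (im_set p == im_set q))%:R)); last first.
  by move=> p; rewrite ms => mp; exact: coeff_actCB.
case: (boolP (matchb _ _)) => mq /=; last by rewrite big1.
(* The image of [q] lies in that of the composite, hence in that of [f], so [f] matches a class with
   this image. By [matchb_uniq] it is the only one, and a single summand survives. *)
have [p mp ip] : exists2 p : CB R k n, matchb f p & im_set p = im_set q.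
  move: mq; have [l [c [psi ->]]] := CBP q; rewrite matchb_class => /asboolP[m1 _].
  have [|phi mphi] := @matches_emb_exists R k l n c f.
    move=> x xc; have [i e] := phi_cover psi (exist _ x xc : im c).
    by exists (g i); rewrite -FI_compE (m1 _ _ e).
  by exists (CB_class phi) => //; rewrite matchb_class; apply/asboolP.
rewrite (bigD1_seq p) ?us ?ms //= ip eqxx big1_seq ?addr0 // => p' /andP[pp' sp'].
case: eqP => // e; rewrite ms in sp'.
by rewrite (matchb_uniq sp' mp) ?eqxx ?ip in pp'.
Qed.

Lemma chi_act (x : ZFI k n) : chi R (actFI g x) = actCB R g (chi R x).
Proof.
rewrite -[x]freeg_sumE !raddf_sum /=; apply: eq_bigr => f _.
have -> : << coeff f x *g f >> = << f >> *~ coeff f x :> ZFI k n.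
  by rewrite freegU_mulz intz.
rewrite !raddfMz /= -chi_actU; congr (chi R _ *~ _).
by rewrite /actFI liftU scale1r.
Qed.

End Equivariance.

Theorem corollary4p11 (R : realType) (n : nat) :
  [/\ (forall k : nat, zmod_morphism (@chi R k n))
      /\ (forall (k k' : nat) (g : FI k' k) (x : ZFI k n),
             chi R (actFI g x) = actCB R g (chi R x)),
      forall k : nat, (2 * k - 1 <= n)%N -> bijective (@chi R k n)
    & forall (k l : nat) (f : FI l k)
             (chiVk : ZCB R k n -> ZFI k n) (chiVl : ZCB R l n -> ZFI l n),
        (2 * k - 1 <= n)%N ->
        cancel (@chi R k n) chiVk -> cancel chiVk (@chi R k n) ->
        cancel (@chi R l n) chiVl -> cancel chiVl (@chi R l n) ->
        forall x : ZCB R k n, actFI f (chiVk x) = chiVl (actCB R f x)].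
Proof.
split; first by split=> k; [exact: chi_is_zmod_morphism|move=> k' g x; exact: chi_act].
  by move=> k; exact: chi_bij.
move=> k l f chiVk chiVl _ _ Vk lV _ x.
(* Writing [x] as [chi] of its preimage turns the claim into equivariance of [chi], followed by
   cancellation at level [l]. *)
by rewrite -{2}[x]Vk -chi_act lV.
Qed.
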